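(* Let $d_{0,\Sigma}$ denote the distance of $(x_0+y_{1,0},\dots,x_0+y_{m,0})$ to $\mathcal S^*(\Sigma)$ and let $\rho,\delta,\epsilon>0$ be given tolerances. Then Algorithm 4 (the inexact operator splitting method for $T_1,\dots,T_m$ described in the context) finds $x_1,\dots,x_m\in\mathcal H$, $u_1,\dots,u_m\in\mathcal H$ and $\varepsilon_1,\dots,\varepsilon_m>0$ satisfying $$u_i\in T_i^{\varepsilon_i}(x_i)\ \ \forall i,\qquad \Big\|\sum_{i=1}^mu_i\Big\|\le\rho,\qquad \|x_i-x_\ell\|\le\delta\ \ \forall i,\ell=1,\dots,m,\qquad \sum_{i=1}^m\varepsilon_i\le\epsilon$$ in at most $$\mathcal O\left(\max\left\{\left\lceil\frac{\sqrt m\,d_{0,\Sigma}}{\rho}\right\rceil,\left\lceil\frac{d_{0,\Sigma}}{\delta}\right\rceil,\left\lceil\frac{d_{0,\Sigma}^2}{\epsilon}\right\rceil\right\}\right)$$ iterations.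
   Context: $\mathcal H$ is a real Hilbert space, $m\ge2$, and $T_i:\mathcal H\rightrightarrows\mathcal H$, $i=1,\dots,m$, are maximal monotone. $\mathcal H^m$ carries the inner product $\langle(x_i),(x_i')\rangle=\sum_{i=1}^m\langle x_i,x_i'\rangle$ and induced norm. For $\varepsilon\ge0$, $T_i^\varepsilon(x):=\{v\in\mathcal H:\langle v'-v,x'-x\rangle\ge-\varepsilon\ \ \forall (x',v')\text{ with }v'\in T_i(x')\}$. The problem is $0\in\sum_{i=1}^mT_i(x)$; its extended solution set, assumed nonempty, is $$\mathcal S^*(\Sigma):=\Big\{(z_i)_{i=1}^m\in\mathcal H^m:\ \exists\,x,u_1,\dots,u_m\in\mathcal H,\ u_i\in T_i(x)\ \forall i,\ \sum_{i=1}^mu_i=0,\ z_i=x+u_i\ \forall i\Big\}.$$ Algorithm 4: given $(x_0,y_{1,0},\dots,y_{m,0})\in\mathcal H^{m+1}$ with $y_{1,0}+\dots+y_{m,0}=0$ and $\sigma\in[0,1[$, for $k=1,2,\dots$: for each $i$ choose any $\tilde x_{i,k}\in\mathcal H$ and $\varepsilon_{i,k}\ge0$ such that $$u_{i,k}:=x_{k-1}+y_{i,k-1}-\tilde x_{i,k}\in T_i^{\varepsilon_{i,k}}(\tilde x_{i,k}),\qquad \varepsilon_{i,k}\le\frac{\sigma^2}{2}\|\tilde x_{i,k}-x_{k-1}\|^2,$$ and set $x_k=\frac1m\sum_{i=1}^m\tilde x_{i,k}$ and $y_{i,k}=u_{i,k}-\frac1m\sum_{\ell=1}^mu_{\ell,k}$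 for $i=1,\dots,m$. The ergodic averages are $\tilde x_{i,k}^a:=\frac1k\sum_{\ell=1}^k\tilde x_{i,\ell}$ and $u_{i,k}^a:=\frac1k\sum_{\ell=1}^ku_{i,\ell}$. Convention: ''finds ... in at most $\mathcal O(N)$ iterations'' means that there is a constant $C$ depending only on $\sigma$ such that for some $k\le C\max\{1,N\}$ the requirements hold, for some $\varepsilon_1,\dots,\varepsilon_m>0$, with $(x_i,u_i)_{i=1}^m$ equal to $(\tilde x_{i,j},u_{i,j})_{i=1}^m$ for some $j\le k$ or to $(\tilde x_{i,k}^a,u_{i,k}^a)_{i=1}^m$. *)

(* Defs.v *)
From mathcomp Require Import all_boot all_order all_algebra.
From mathcomp Require Import all_classical all_reals all_analysis.

Set Implicit Arguments.
Unset Strict Implicit.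
Unset Printing Implicit Defensive.

Import Order.TTheory GRing.Theory Num.Theory.
Import numFieldNormedType.Exports.

Local Open Scope classical_set_scope.
Local Open Scope ring_scope.

(* A real Hilbert space is a complete normed module [H] with an inner product
   [ip] (a positive definite symmetric bilinear form) inducing its norm. *)
Definition induces_norm (R : realType) (H : completeNormedModType R)
    (ip : {dot H for idfun}) : Prop :=
  forall x : H, ip x x = `|x| ^+ 2.

Section Operators.
Context {R : realType} {H : completeNormedModType R}.
Variable ip : {dot H for idfun}.

(* Set-valued operators on [H] are functions [T : H -> set H]; [T x v] means
   [v \in T(x)]. *)
Definition monotone (T : H -> set H) : Prop :=
  forall x v x' v', T x v -> T x' v' -> 0 <= ip (v' - v) (x' - x).

Definition maximal_monotone (T : H -> set H) : Prop :=
  monotone T /\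
  forall S : H -> set H,
    monotone S -> (forall x, T x `<=` S x) -> forall x, S x `<=` T x.

Definition enlargement (e : R) (T : H -> set H) (x : H) : set H :=
  [set v | forall x' v', T x' v' -> - e <= ip (v' - v) (x' - x)].

End Operators.

(* Elements of H^m are functions ['I_m -> H]. The norm on H^m is the one
   induced by the sum inner product, not the library's sup norm. *)
Section ProductSpace.
Context {R : realType} {H : completeNormedModType R} {m : nat}.
Variable ip : {dot H for idfun}.

Definition ip_prod (z z' : 'I_m -> H) : R := \sum_(i < m) ip (z i) (z' i).

Definition norm_prod (z : 'I_m -> H) : R := Num.sqrt (ip_prod z z).

Definition dist_prod (z : 'I_m -> H) (S : set ('I_m -> H)) : R :=
  inf [set norm_prod (fun i => z i - w i) | w in S].

End ProductSpace.

Section Splitting.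
Context {R : realType} {H : completeNormedModType R} {m : nat}.
Variable ip : {dot H for idfun}.

Definition extended_solution_set (T : 'I_m -> H -> set H) : set ('I_m -> H) :=
  [set z | exists (x : H) (u : 'I_m -> H),
    [/\ forall i, T i x (u i),
        \sum_(i < m) u i = 0 &
        forall i, z i = x + u i]].

(* [xt], [u], [eps] are indexed by the iteration number k >= 1; their values
   at index 0 are irrelevant. [x] and [y] start at index 0. *)
Record algorithm4 (T : 'I_m -> H -> set H) (sigma : R)
    (x : nat -> H) (y : nat -> 'I_m -> H)
    (xt u : nat -> 'I_m -> H) (eps : nat -> 'I_m -> R) : Prop := {
  alg4_init : \sum_(i < m) y 0%N i = 0;
  alg4_eps_ge0 : forall k i, 0 <= eps k.+1 i;
  alg4_u : forall k i, u k.+1 i = x k + y k i - xt k.+1 i;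
  alg4_enl : forall k i,
    enlargement ip (eps k.+1 i) (T i) (xt k.+1 i) (u k.+1 i);
  alg4_eps_le : forall k i,
    eps k.+1 i <= sigma ^+ 2 / 2 * `|xt k.+1 i - x k| ^+ 2;
  alg4_x : forall k, x k.+1 = m%:R^-1 *: \sum_(i < m) xt k.+1 i;
  alg4_y : forall k i,
    y k.+1 i = u k.+1 i - m%:R^-1 *: \sum_(l < m) u k.+1 l
}.

Definition ergodic (s : nat -> 'I_m -> H) (k : nat) (i : 'I_m) : H :=
  k%:R^-1 *: \sum_(1 <= l < k.+1) s l i.

Definition approx_solution (T : 'I_m -> H -> set H) (rho delta epsilon : R)
    (x u : 'I_m -> H) : Prop :=
  exists e : 'I_m -> R,
    [/\ forall i, 0 < e i,
        forall i, enlargement ip (e i) (T i) (x i) (u i),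
        `|\sum_(i < m) u i| <= rho,
        forall i l, `|x i - x l| <= delta &
        \sum_(i < m) e i <= epsilon].

(* Some iterate among the first [k], or the [k]-th ergodic average, meets the
   requirements. *)
Definition finds_at (T : 'I_m -> H -> set H) (rho delta epsilon : R)
    (xt u : nat -> 'I_m -> H) (k : nat) : Prop :=
  (exists2 j : nat, (1 <= j <= k)%N &
     approx_solution T rho delta epsilon (xt j) (u j)) \/
  approx_solution T rho delta epsilon (ergodic xt k) (ergodic u k).

End Splitting.

(* Main.v *)
Require Import Defs.
From mathcomp Require Import all_boot all_order all_algebra.
From mathcomp Require Import all_classical all_reals all_analysis.
From mathcomp Require Import ring lra.

Set Implicit Arguments.
Unset Strict Implicit.
Unset Printing Implicit Defensive.

Import Order.TTheory GRing.Theory Num.Theory.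
Import numFieldNormedType.Exports.

Local Open Scope classical_set_scope.
Local Open Scope ring_scope.

(** Write [z_k i = x_k + y_k i], a point of H^m.  One iteration sends [z_k] to
    [z_(k+1) i = 2 x_(k+1) + y_k i - xt_(k+1) i], and for every [c] of the form
    [c i = v + w i] with [w] of zero sum, an exact identity
    ([splitting_step_identity]) gives the decrease of the squared distance to
    [c]:

      |z_k - c|^2 - |z_(k+1) - c|^2
        = 2 sum_i <xt_(k+1) i - v, u_(k+1) i - w i>
          + sum_i |xt_(k+1) i - x_k|^2.

    As [sigma < 1], the error criterion ensures that the last sum is at least
    twice the sum of the errors [eps_(k+1) i], so

      2 sum_i (eps_(k+1) i + <xt_(k+1) i - v, u_(k+1) i - w i>)
        <= |z_k - c|^2 - |z_(k+1) - c|^2                       ([alg4_step_ge]).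

    This inequality is used with two choices of [c].

    - [c] in the extended solution set.  The left-hand side is then nonnegative
      by definition of the enlargement, so the distance of [z_k] to each
      solution [zs] never increases, and [z_0 - z_k] has norm at most
      [2 |z_0 - zs|].  The residuals of the ergodic averages (the sum of the
      [u]'s, and the differences of the [x]'s) depend only on [(z_0 - z_k) / k],
      because the per-iteration residuals telescope; they are thus O(1/k).

    - [c] the average of [z_1, ..., z_k].  Averaging points of the graphs of the
      enlargements of [T i] gives a point of an enlargement whose error
      [ergodic_eps i] is the mean of the errors plus a covariance
      ([enlargement_average]).  Summed over [i], the covariances do not change
      when the averages of the [xt]'s and [u]'s are replaced by the two parts
      [v], [w] of [c], so the inequality telescopes and bounds the total error
      by [|z_0 - c|^2 / (2 k)], which is O(1/k).

    All bounds have the form [const * |z_0 - zs|] or its square for an arbitrary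
    solution [zs], so they pass to the infimum [d0].  After [k = 4 N] iterations
    with [N] the maximum in the theorem, the ergodic averages meet the three
    tolerances; half of [epsilon] is kept to make the errors positive, which is
    possible because the errors found are nonnegative by maximality of [T i]
    ([enlargement_ge0]).  The constant [C = 4] serves for every [sigma]. *)

(** * Inner products and averages *)

Section InnerProduct.
Context {R : realType} {H : completeNormedModType R}.
Variable ip : {dot H for idfun}.

Lemma ipC (a b : H) : ip a b = ip b a.
Proof. by rewrite hermC expr0 mul1r. Qed.

Lemma ipDl (a b c : H) : ip (a + b) c = ip a c + ip b c.
Proof. exact: linearDl. Qed.

Lemma ipDr (a b c : H) : ip c (a + b) = ip c a + ip c b.
Proof. exact: linearDr. Qed.

Lemma ipNl (a c : H) : ip (- a) c = - ip a c.
Proof. exact: linearNl. Qed.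

Lemma ipNr (a c : H) : ip c (- a) = - ip c a.
Proof. exact: linearNr. Qed.

Lemma ipZl k (a c : H) : ip (k *: a) c = k * ip a c.
Proof. by rewrite linearZl_LR. Qed.

Lemma ipZr k (a c : H) : ip c (k *: a) = k * ip c a.
Proof. by rewrite linearZr. Qed.

Lemma ip0l (c : H) : ip 0 c = 0.
Proof. exact: linear0l. Qed.

Lemma ip_suml I (r : seq I) (F : I -> H) (c : H) :
  ip (\sum_(i <- r) F i) c = \sum_(i <- r) ip (F i) c.
Proof. exact: linear_sumlz. Qed.

Lemma ip_sumr I (r : seq I) (F : I -> H) (c : H) :
  ip c (\sum_(i <- r) F i) = \sum_(i <- r) ip c (F i).
Proof. exact: linear_sumr. Qed.

Definition ipE := (ipDl, ipDr, ipNl, ipNr, ipZl, ipZr).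

Hypothesis hip : induces_norm ip.

(** Convexity of the squared norm, read off from the nonnegativity of the sum
    of the [|n a_i - S|^2], [S] being the sum and [n] the number of terms. *)
Lemma sqnorm_sum_le I (r : seq I) (a : I -> H) :
  `|\sum_(i <- r) a i| ^+ 2 <= (size r)%:R * \sum_(i <- r) `|a i| ^+ 2.
Proof.
case: (posnP (size r)) => [/size0nil ->|r_gt0].
  by rewrite !big_nil normr0 expr0n /= mulr0.
set n : R := (size r)%:R; set S := \sum_(i <- r) a i.
have n_gt0 : 0 < n by rewrite ltr0n.
have: 0 <= \sum_(i <- r) `|n *: a i - S| ^+ 2.
  by apply: sumr_ge0 => i _; exact: sqr_ge0.
rewrite (eq_bigr (fun i => n ^+ 2 * `|a i| ^+ 2 + (- 2 * n) * ip (a i) S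
    + `|S| ^+ 2)); last first.
  by move=> i _; rewrite -!hip !ipE (ipC S (a i)); ring.
rewrite !big_split /= big_const_seq count_predT iter_addr_0.
rewrite -!mulr_sumr -ip_suml -/S hip -(mulr_natl (`|S| ^+ 2)) -/n.
set A := \sum_(i <- r) _; set B := `|S| ^+ 2 => nonneg.
rewrite -(ler_pM2l n_gt0). lra.
Qed.

(** [ergodic s k i] is convertible to [average (s ^~ i) k]. *)
Definition average (s : nat -> H) (k : nat) : H :=
  k%:R^-1 *: \sum_(1 <= l < k.+1) s l.

Lemma sum_average (s : nat -> H) (k : nat) :
  (0 < k)%N -> \sum_(1 <= l < k.+1) s l = k%:R *: average s k.
Proof.
by move=> k_gt0; rewrite scalerA divff ?scale1r // pnatr_eq0 -lt0n.
Qed.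

(** Parallel axis theorem for covariances: centring at [(c, d)] rather than at
    the means costs the covariance of the means with [(c, d)]. *)
Lemma sum_ip_average (s r : nat -> H) (k : nat) (c d : H) : (0 < k)%N ->
  \sum_(1 <= l < k.+1) ip (s l - c) (r l - d)
  = \sum_(1 <= l < k.+1) ip (s l - average s k) (r l - average r k)
    + k%:R * ip (average s k - c) (average r k - d).
Proof.
move=> k_gt0; set sa := average s k; set ra := average r k.
rewrite (eq_bigr (fun l => ip (s l - sa) (r l - ra)
    + (ip (s l) (ra - d) + ip (sa - c) (r l)
       + (ip c d - ip sa ra)))); last first.
  by move=> l _; rewrite !ipE; ring.
rewrite !big_split /= -ip_suml -ip_sumr !sum_average // -/sa -/ra.
by rewrite !sumr_const_nat subn1 /= !ipE; ring.
Qed.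

(** The slack is [|(a - c) + (b - c)|^2], by the parallelogram law. *)
Lemma sqnormB_le (a b c : H) :
  `|a - b| ^+ 2 <= 2 * `|a - c| ^+ 2 + 2 * `|b - c| ^+ 2.
Proof.
have: 0 <= `|(a - c) + (b - c)| ^+ 2 by exact: sqr_ge0.
suff -> : `|(a - c) + (b - c)| ^+ 2 =
  2 * `|a - c| ^+ 2 + 2 * `|b - c| ^+ 2 - `|a - b| ^+ 2 by rewrite subr_ge0.
rewrite -!hip !ipE (ipC b a) (ipC c a) (ipC c b); ring.
Qed.

End InnerProduct.

(** * Enlargements of monotone operators *)

Section Enlargement.
Context {R : realType} {H : completeNormedModType R}.
Variable ip : {dot H for idfun}.

Lemma enlargementW (T : H -> set H) (e e' : R) (x v : H) :
  e <= e' -> enlargement ip e T x v -> enlargement ip e' T x v.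
Proof.
by move=> ee' Txv x' v' /Txv; apply: le_trans; rewrite lerN2.
Qed.

(** With a negative error, [(x, v)] would be monotonically related to the whole
    graph of [T], hence belong to it by maximality; testing the enlargement
    inequality at [(x, v)] itself then gives [- e <= 0]. *)
Lemma enlargement_ge0 (T : H -> set H) (e : R) (x v : H) :
  maximal_monotone ip T -> enlargement ip e T x v -> 0 <= e.
Proof.
move=> [Tmon Tmax] Txv; rewrite leNgt; apply/negP => e_lt0.
pose S (x' : H) : set H := [set v' | T x' v' \/ (x' = x /\ v' = v)].
have Txv_ge0 x' v' : T x' v' -> 0 <= ip (v' - v) (x' - x).
  by move=> /Txv; apply: le_trans; rewrite oppr_ge0 ltW.
have Smon : Defs.monotone ip S.
  move=> a s a' s' [Ts|[-> ->]] [Ts'|[-> ->]].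
  - exact: Tmon Ts Ts'.
  - by rewrite -(opprB s) -(opprB a) ipNl ipNr opprK; exact: Txv_ge0.
  - exact: Txv_ge0.
  - by rewrite !subrr ip0l.
have Txv' : T x v.
  by apply: (Tmax _ Smon) => [a s Tas|]; [left|right].
move: (Txv _ _ Txv'); rewrite !subrr ip0l oppr_le0 leNgt.
by rewrite e_lt0.
Qed.

(** The transportation formula for enlargements: the mean of the inequalities at
    the points [(s l, r l)], recentred at the averages by the parallel axis
    theorem. *)
Lemma enlargement_average (T : H -> set H) (s r : nat -> H) (e : nat -> R)
    (k : nat) :
  (0 < k)%N ->
  (forall l, (0 < l)%N -> enlargement ip (e l) T (s l) (r l)) ->
  enlargement ip
    (k%:R^-1 * \sum_(1 <= l < k.+1)
      (e l + ip (s l - average s k) (r l - average r k)))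
    T (average s k) (average r k).
Proof.
move=> k_gt0 Tsr x' v' Txv.
have kR_gt0 : 0 < k%:R :> R by rewrite ltr0n.
rewrite -mulrN ler_pdivrMl // lerNl -subr_ge0 opprK big_split /= -addrA.
rewrite -(opprB _ v') -(opprB _ x') ipNl ipNr opprK (ipC _ (_ - v')).
rewrite -sum_ip_average // -big_split big_seq_cond /=.
apply: sumr_ge0 => l; rewrite mem_index_iota => /andP[/andP[l_gt0 _] _].
rewrite ipC -(opprB v') -(opprB x') ipNl ipNr opprK.
by rewrite -lerBlDl sub0r; exact: Tsr.
Qed.

End Enlargement.

(** * One splitting step in the product space *)

Section SplittingStep.
Context {R : realType} {H : completeNormedModType R} {m : nat}.
Variable ip : {dot H for idfun}.
Hypothesis hip : induces_norm ip.

Definition sqdist (z c : 'I_m -> H) : R := \sum_(i < m) `|z i - c i| ^+ 2.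

Lemma sqdist_ge0 (z c : 'I_m -> H) : 0 <= sqdist z c.
Proof. by apply: sumr_ge0 => i _; exact: sqr_ge0. Qed.

Lemma sqdistE (z c : 'I_m -> H) :
  sqdist z c = norm_prod ip (fun i => z i - c i) ^+ 2.
Proof.
have sqdist_ip :
    ip_prod ip (fun i => z i - c i) (fun i => z i - c i) = sqdist z c.
  by apply: eq_bigr => i _; rewrite hip.
by rewrite /norm_prod sqdist_ip sqr_sqrtr // sqdist_ge0.
Qed.

Lemma sqdist_le (a b c : 'I_m -> H) :
  sqdist a b <= 2 * sqdist a c + 2 * sqdist b c.
Proof.
rewrite /sqdist !mulr_sumr -big_split /=; apply: ler_sum => i _.
exact: sqnormB_le.
Qed.

Lemma sqdist_average_le (c : 'I_m -> H) (z : nat -> 'I_m -> H) (k : nat) :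
  (0 < k)%N ->
  k%:R * sqdist c (ergodic z k) <= \sum_(1 <= l < k.+1) sqdist c (z l).
Proof.
move=> k_gt0; have kR_gt0 : 0 < k%:R :> R by rewrite ltr0n.
rewrite /sqdist mulr_sumr exchange_big /=; apply: ler_sum => i _.
rewrite -(ler_pM2l kR_gt0) mulrA -expr2.
have := sqnorm_sum_le hip (index_iota 1 k.+1) (fun l => c i - z l i).
rewrite size_iota subn1 /=; apply: le_trans.
have -> : \sum_(1 <= l < k.+1) (c i - z l i) = k%:R *: (c i - ergodic z k i).
  rewrite sumrB sumr_const_nat subn1 /= scalerBr /ergodic scalerA.
  by rewrite divff ?gt_eqF // scale1r scaler_nat.
by rewrite normrZ exprMn ger0_norm // ltW.
Qed.

(** The new point joins the diagonal part [p] of [a] with the zero-sum part of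
    [x + y i - a i].  The move is then [(a i - p) + (x - p)], while the error
    [a i - x] is [(a i - p) - (x - p)]: since zero-sum and diagonal vectors are
    orthogonal in H^m, both have the same length, and the scalar products of the
    move with the distance to [v + w i] regroup into the one on the right. *)
Lemma splitting_step_identity (x p v : H) (y a w : 'I_m -> H) :
  \sum_(i < m) (a i - p) = 0 -> \sum_(i < m) y i = 0 -> \sum_(i < m) w i = 0 ->
  sqdist (fun i => x + y i) (fun i => v + w i)
    - sqdist (fun i => p + (p + y i - a i)) (fun i => v + w i)
  = 2 * (\sum_(i < m) ip (a i - v) (x + y i - a i - w i))
    + \sum_(i < m) `|a i - x| ^+ 2.
Proof.
move=> sum_a sum_y sum_w.
(* The difference of the two sides at index [i]; each term pairs a zero-sum
   family with a vector that does not depend on [i]. *)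
have cross0 : \sum_(i < m) (2 * ip (y i - w i) (x - p - p + v)
    + 4 * ip (a i - p) (p - v)) = 0.
  rewrite big_split -!mulr_sumr -!ip_suml sum_a sumrB sum_y sum_w subr0 /=.
  by rewrite !ip0l !mulr0 addr0.
rewrite -[RHS]addr0 -[X in _ = _ + X]cross0 /sqdist -sumrB mulr_sumr.
rewrite -!big_split /=.
apply: eq_bigr => i _; rewrite -!hip !ipE.
rewrite ?(ipC _ (a i) x) ?(ipC _ (y i) x) ?(ipC _ (w i) x).
rewrite ?(ipC _ p x) ?(ipC _ v x) ?(ipC _ (y i) (a i)) ?(ipC _ (w i) (a i)).
rewrite ?(ipC _ p (a i)) ?(ipC _ v (a i)).
rewrite ?(ipC _ (w i) (y i)) ?(ipC _ p (y i)) ?(ipC _ v (y i)).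
rewrite ?(ipC _ p (w i)) ?(ipC _ v (w i)) ?(ipC _ v p).
ring.
Qed.

End SplittingStep.

(** * The iterates of the algorithm *)

Section Algorithm.
Context {R : realType} {H : completeNormedModType R} {m : nat}.
Variable ip : {dot H for idfun}.
Variables (T : 'I_m -> H -> set H) (sigma : R).
Variables (x : nat -> H) (y xt u : nat -> 'I_m -> H) (eps : nat -> 'I_m -> R).
Hypothesis hip : induces_norm ip.
Hypothesis m_gt0 : (0 < m)%N.
Hypothesis hsigma : 0 <= sigma < 1.
Hypothesis alg : algorithm4 ip T sigma x y xt u eps.

Let mR_gt0 : 0 < m%:R :> R. Proof. by rewrite ltr0n. Qed.

Let z k i := x k + y k i.

Lemma alg4_sum_y k : \sum_(i < m) y k i = 0.
Proof.
case: k => [|k]; first exact: alg4_init alg.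
under eq_bigr do rewrite (alg4_y alg).
rewrite sumrB sumr_const card_ord -scaler_nat scalerA.
by rewrite divff ?gt_eqF // scale1r subrr.
Qed.

Lemma alg4_sum_xt k : \sum_(i < m) xt k.+1 i = m%:R *: x k.+1.
Proof. by rewrite (alg4_x alg) scalerA divff ?gt_eqF // scale1r. Qed.

Lemma alg4_sum_u k : \sum_(i < m) u k.+1 i = m%:R *: (x k - x k.+1).
Proof.
under eq_bigr do rewrite (alg4_u alg).
rewrite sumrB big_split /= alg4_sum_y addr0 alg4_sum_xt sumr_const card_ord.
by rewrite -scaler_nat scalerBr.
Qed.

(** The mean of the [u]'s is [x k - x k.+1], so the new [z] involves the [u]'s
    only through [y] and [xt]. *)
Lemma alg4_reflection k i : z k.+1 i = x k.+1 + (x k.+1 + y k i - xt k.+1 i).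
Proof.
rewrite /z (alg4_y alg) alg4_sum_u scalerA mulVf ?gt_eqF // scale1r.
rewrite (alg4_u alg).
by congr (_ + _); rewrite opprB addrC -!addrA addKr.
Qed.

Lemma alg4_step k (v : H) (w : 'I_m -> H) :
  \sum_(i < m) w i = 0 ->
  sqdist (z k) (fun i => v + w i) - sqdist (z k.+1) (fun i => v + w i)
  = 2 * (\sum_(i < m) ip (xt k.+1 i - v) (u k.+1 i - w i))
    + \sum_(i < m) `|xt k.+1 i - x k| ^+ 2.
Proof.
move=> sum_w.
have sum_a : \sum_(i < m) (xt k.+1 i - x k.+1) = 0.
  by rewrite sumrB alg4_sum_xt sumr_const card_ord scaler_nat subrr.
have := splitting_step_identity hip (x k) v sum_a (alg4_sum_y k) sum_w.
rewrite (_ : (fun i => x k.+1 + _) = z k.+1); last first.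
  by apply/funext => i; rewrite alg4_reflection.
rewrite /z => ->; congr (2 * _ + _); apply: eq_bigr => i _.
by rewrite (alg4_u alg).
Qed.

Lemma alg4_sum_eps_le k :
  2 * (\sum_(i < m) eps k.+1 i) <= \sum_(i < m) `|xt k.+1 i - x k| ^+ 2.
Proof.
rewrite mulr_sumr; apply: ler_sum => i _.
have [sigma_ge0 sigma_lt1] := andP hsigma.
have sigma2_le1 : sigma ^+ 2 <= 1 by rewrite expr_le1 // ltW.
have := alg4_eps_le alg k i; have := sqr_ge0 `|xt k.+1 i - x k|; nra.
Qed.

(** The descent inequality: the inexactness is paid for by the squared length of
    the step. *)
Lemma alg4_step_ge k (v : H) (w : 'I_m -> H) :
  \sum_(i < m) w i = 0 ->
  2 * (\sum_(i < m) (eps k.+1 i + ip (xt k.+1 i - v) (u k.+1 i - w i)))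
  <= sqdist (z k) (fun i => v + w i) - sqdist (z k.+1) (fun i => v + w i).
Proof.
move=> sum_w; rewrite alg4_step // big_split /= mulrDr addrC lerD2l.
exact: alg4_sum_eps_le.
Qed.

(** At a solution [v + w], the left-hand side of the descent inequality is a sum
    of quantities that are nonnegative by definition of the enlargement. *)
Lemma alg4_fejer k zs :
  extended_solution_set T zs -> sqdist (z k) zs <= sqdist (z 0%N) zs.
Proof.
move=> [xs [us [Tus sum_us defzs]]].
elim: k => // k; apply: le_trans.
rewrite (_ : zs = (fun i => xs + us i)); last exact/funext.
rewrite -subr_ge0; apply: le_trans (alg4_step_ge k xs sum_us).
apply: mulr_ge0 => //; apply: sumr_ge0 => i _.
have := alg4_enl alg k (Tus i).
rewrite -(opprB (u _ _)) -(opprB (xt _ _)) ipNl ipNr opprK ipC.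
by rewrite -[_ <= _]subr_ge0 opprK addrC.
Qed.

Lemma alg4_drift k zs :
  extended_solution_set T zs -> sqdist (z 0%N) (z k) <= 4 * sqdist (z 0%N) zs.
Proof.
move=> Szs; apply: le_trans (sqdist_le hip _ _ zs) _.
have := alg4_fejer k Szs; lra.
Qed.

(** * Ergodic averages *)

Section Ergodic.
Variable k : nat.
Hypothesis k_gt0 : (0 < k)%N.

Let kR_gt0 : 0 < k%:R :> R. Proof. by rewrite ltr0n. Qed.

(* The mean displacement of [z] over the first [k] iterations, which carries
   all the residual information about the ergodic averages. *)
Let g i := k%:R^-1 *: (z 0%N i - z k i).

(** Since [y] has zero sum, both sides equal [m / k *: (x 0 - x k)]: the sum of
    the [u]'s at an iteration is [m] times the decrease of [x]. *)
Lemma sum_ergodic_u : \sum_(i < m) ergodic u k i = \sum_(i < m) g i.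
Proof.
rewrite -!scaler_sumr exchange_big /=; congr (_ *: _).
rewrite sumrB !big_split /= !alg4_sum_y !addr0 !sumr_const card_ord.
rewrite big_add1 /= (eq_bigr _ (fun l _ => alg4_sum_u l)) -scaler_sumr.
rewrite scaler_nat -mulrnBl; congr (_ *+ _).
rewrite -[LHS]opprK -sumrN -opprB; congr (- _).
rewrite -(telescope_sumr x (leq0n k)).
by apply: eq_bigr => l _; rewrite opprB.
Qed.

(** The decrease of [z] at an iteration is [xt] plus a vector that is the same
    for all indices, and therefore drops out of differences. *)
Lemma ergodic_xtB i j : ergodic xt k i - ergodic xt k j = g i - g j.
Proof.
rewrite -!scalerBr; congr (_ *: _).
have drift i' : z 0%N i' - z k i'
    = \sum_(1 <= l < k.+1) xt l i' + \sum_(0 <= l < k) (x l - x l.+1 - x l.+1).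
  rewrite big_add1 /= -big_split /= -opprB.
  rewrite -(telescope_sumr (z ^~ i') (leq0n k)).
  rewrite -sumrN; apply: eq_bigr => l _; rewrite alg4_reflection /z opprB.
  rewrite !opprD opprK !addrA [LHS]addrC -!addrA; congr (_ + _).
  by rewrite addrCA addrC -!addrA addNr addr0.
by rewrite !drift opprD addrACA subrr addr0.
Qed.

Lemma sum_g_le zs : extended_solution_set T zs ->
  \sum_(i < m) `|g i| ^+ 2 <= 4 * sqdist (z 0%N) zs / k%:R ^+ 2.
Proof.
move=> Szs; have := alg4_drift k Szs.
rewrite ler_pdivlMr ?exprn_gt0 //; apply: le_trans.
rewrite mulr_suml /sqdist; apply: ler_sum => i _.
rewrite normrZ exprMn normfV (ger0_norm (ltW kR_gt0)) exprVn mulrC mulVKf //.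
by rewrite expf_neq0 // gt_eqF.
Qed.

(** Convexity over the [m] indices is where the factor [sqrt m] comes from. *)
Lemma ergodic_sum_u_le zs : extended_solution_set T zs ->
  `|\sum_(i < m) ergodic u k i|
    <= 2 * Num.sqrt m%:R / k%:R * norm_prod ip (fun i => z 0%N i - zs i).
Proof.
move=> Szs; rewrite sum_ergodic_u.
rewrite -ler_sqr ?nnegrE //; last first.
  by rewrite mulr_ge0 ?sqrtr_ge0 // divr_ge0 ?mulr_ge0 ?sqrtr_ge0.
apply: le_trans (sqnorm_sum_le hip _ _) _.
rewrite -sum1_size sum1_card card_ord.
rewrite exprMn -(sqdistE hip) !exprMn sqr_sqrtr ?ler0n // exprVn.
have := sum_g_le Szs; rewrite -(ler_pM2l mR_gt0) => /le_trans; apply.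
rewrite le_eqVlt; apply/orP; left; apply/eqP; ring.
Qed.

Lemma ergodic_xtB_le zs i j : extended_solution_set T zs ->
  `|ergodic xt k i - ergodic xt k j|
    <= 4 / k%:R * norm_prod ip (fun i => z 0%N i - zs i).
Proof.
move=> Szs; rewrite ergodic_xtB; apply: le_trans (ler_normB _ _) _.
suff g_le l : `|g l| <= 2 / k%:R * norm_prod ip (fun i => z 0%N i - zs i).
  have := g_le i; have := g_le j; lra.
rewrite -ler_sqr ?nnegrE //; last first.
  by rewrite mulr_ge0 ?sqrtr_ge0 // divr_ge0.
rewrite exprMn -(sqdistE hip) exprMn exprVn.
have := sum_g_le Szs; rewrite (bigD1 l) //=.
have : 0 <= \sum_(i0 < m | i0 != l) `|g i0| ^+ 2.
  by apply: sumr_ge0 => ? _; exact: sqr_ge0.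
lra.
Qed.

(** The error at which averaging places the ergodic point in the enlargement of
    [T i]. *)
Definition ergodic_eps i : R :=
  k%:R^-1 * \sum_(1 <= l < k.+1)
    (eps l i + ip (xt l i - ergodic xt k i) (u l i - ergodic u k i)).

Lemma ergodic_enlargement i :
  enlargement ip (ergodic_eps i) (T i) (ergodic xt k i) (ergodic u k i).
Proof.
by apply: enlargement_average => // -[//|l] _; exact: alg4_enl alg l i.
Qed.

(** The telescoped descent inequality at [c = ergodic z k], whose diagonal and
    zero-sum parts are the averages [v] of [x] and [w] of [y].  The constant is
    [(1/2) * 4]: half from the descent, and 4 from [|z_0 - z_l|^2], averaged
    over [l]. *)
Lemma ergodic_eps_le zs : extended_solution_set T zs ->
  \sum_(i < m) ergodic_eps i
    <= 2 / k%:R * norm_prod ip (fun i => z 0%N i - zs i) ^+ 2.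
Proof.
move=> Szs; rewrite -(sqdistE hip).
set v := average x k; set w := ergodic y k.
have sum_w : \sum_(i < m) w i = 0.
  rewrite -scaler_sumr exchange_big /=.
  by under eq_bigr do rewrite alg4_sum_y; rewrite big1_eq scaler0.
have sum_xta : \sum_(i < m) (ergodic xt k i - v) = 0.
  rewrite sumrB -scaler_sumr exchange_big /= big_add1 /=.
  under eq_bigr do rewrite alg4_sum_xt.
  by rewrite -scaler_sumr scalerA mulrC -scalerA /v /average big_add1 /=
    sumr_const card_ord scaler_nat subrr.
set q := k%:R^-1 *: \sum_(0 <= l < k) (x l - x l.+1).
(* The averages of [u] and [y] differ by a diagonal vector. *)
have uaB i : ergodic u k i - w i = q.
  rewrite -scalerBr -sumrB big_add1 /=; congr (_ *: _); apply: eq_bigr => l _.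
  by rewrite (alg4_y alg) opprB addrCA subrr addr0 alg4_sum_u scalerA
    mulVf ?gt_eqF // scale1r.
have za_split : ergodic z k = (fun i => v + w i).
  by apply/funext => i; rewrite /ergodic big_split scalerDr.
(* The correction of the parallel axis theorem pairs the zero-sum family
   [ergodic xt k - v] with the constant [q]. *)
have centre : \sum_(i < m) \sum_(1 <= l < k.+1)
      ip (xt l i - ergodic xt k i) (u l i - ergodic u k i)
    = \sum_(i < m) \sum_(1 <= l < k.+1) ip (xt l i - v) (u l i - w i).
  have cross0 : \sum_(i < m) k%:R * ip (ergodic xt k i - v) q = 0.
    by rewrite -mulr_sumr -ip_suml sum_xta ip0l mulr0.
  apply/esym; rewrite -[RHS]addr0 -[X in _ = _ + X]cross0 -big_split.
  by apply: eq_bigr => i _ /=; rewrite sum_ip_average // -(uaB i).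
have descent : 2 * (\sum_(i < m) \sum_(1 <= l < k.+1)
      (eps l i + ip (xt l i - v) (u l i - w i)))
    <= sqdist (z 0%N) (ergodic z k).
  rewrite exchange_big /= big_add1 /= mulr_sumr.
  apply: (@le_trans _ _ (\sum_(0 <= l < k)
    (- (sqdist (z l.+1) (ergodic z k) - sqdist (z l) (ergodic z k))))).
    by apply: ler_sum => l _; rewrite opprB za_split; exact: alg4_step_ge.
  rewrite sumrN telescope_sumr // opprB gerBl; exact: sqdist_ge0.
have za_near : sqdist (z 0%N) (ergodic z k) <= 4 * sqdist (z 0%N) zs.
  rewrite -(ler_pM2l kR_gt0).
  apply: le_trans (sqdist_average_le hip _ _ k_gt0) _.
  apply: le_trans (ler_sum _ (fun l _ => alg4_drift l Szs)) _.
  by rewrite sumr_const_nat subn1 (mulr_natl (4 * _)).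
rewrite /ergodic_eps -mulr_sumr ler_pdivrMl //.
rewrite mulrA (mulrCA k%:R) divff ?gt_eqF // mulr1.
move: descent; under eq_bigr do rewrite big_split; rewrite big_split /= -centre.
under [X in _ -> X <= _]eq_bigr do rewrite big_split; rewrite big_split /=.
lra.
Qed.

End Ergodic.

End Algorithm.

(** * From all solutions to the distance *)

Lemma le_dist_prod (R : realType) (H : completeNormedModType R) (m : nat)
    (ip : {dot H for idfun}) (S : set ('I_m -> H)) (z : 'I_m -> H) (a c : R) :
  S !=set0 -> 0 < c ->
  (forall w, S w -> a <= c * norm_prod ip (fun i => z i - w i)) ->
  a <= c * dist_prod ip z S.
Proof.
move=> [w0 Sw0] c_gt0 a_le; rewrite -ler_pdivrMl //.
apply: lb_le_inf => [|_ [w Sw <-]].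
  by exists (norm_prod ip (fun i => z i - w0 i)), w0.
by rewrite ler_pdivrMl //; exact: a_le.
Qed.

Lemma dist_prod_ge0 (R : realType) (H : completeNormedModType R) (m : nat)
    (ip : {dot H for idfun}) (S : set ('I_m -> H)) (z : 'I_m -> H) :
  S !=set0 -> 0 <= dist_prod ip z S.
Proof.
move=> S0; rewrite -[dist_prod _ _ _]mul1r; apply: le_dist_prod => // w _.
by rewrite mul1r sqrtr_ge0.
Qed.

Lemma le_sqr_dist_prod (R : realType) (H : completeNormedModType R) (m : nat)
    (ip : {dot H for idfun}) (S : set ('I_m -> H)) (z : 'I_m -> H) (a c : R) :
  S !=set0 -> 0 <= a -> 0 < c ->
  (forall w, S w -> a <= c * norm_prod ip (fun i => z i - w i) ^+ 2) ->
  a <= c * dist_prod ip z S ^+ 2.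
Proof.
move=> S0 a_ge0 c_gt0 a_le.
have sqrt_le : Num.sqrt a <= Num.sqrt c * dist_prod ip z S.
  apply: le_dist_prod; rewrite ?sqrtr_gt0 // => w Sw.
  rewrite -(ger0_norm (sqrtr_ge0 _ : 0 <= norm_prod ip _)) -sqrtr_sqr.
  rewrite -sqrtrM ?(ltW c_gt0) // ler_wsqrtr //; exact: a_le.
rewrite -(sqr_sqrtr a_ge0) -(sqr_sqrtr (ltW c_gt0)) -exprMn.
by rewrite ler_sqr ?nnegrE ?mulr_ge0 ?sqrtr_ge0 ?dist_prod_ge0.
Qed.

(** * Iteration complexity *)

Theorem theorem4p2 (R : realType) (sigma : R) (hsigma : 0 <= sigma < 1) :
  exists C : R,
  forall (H : completeNormedModType R) (ip : {dot H for idfun})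
    (m : nat) (T : 'I_m -> H -> set H)
    (x : nat -> H) (y xt u : nat -> 'I_m -> H) (eps : nat -> 'I_m -> R)
    (d0 rho delta epsilon : R),
  induces_norm ip ->
  (2 <= m)%N ->
  (forall i, maximal_monotone ip (T i)) ->
  extended_solution_set T !=set0 ->
  algorithm4 ip T sigma x y xt u eps ->
  d0 = dist_prod ip (fun i => x 0%N + y 0%N i) (extended_solution_set T) ->
  0 < rho -> 0 < delta -> 0 < epsilon ->
  exists k : nat,
    [/\ (1 <= k)%N,
        k%:R <= C * (Num.max 1
          (Num.max (Num.ceil (Num.sqrt m%:R * d0 / rho))
            (Num.max (Num.ceil (d0 / delta))
                     (Num.ceil (d0 ^+ 2 / epsilon)))))%:~R &
        finds_at ip T rho delta epsilon xt u k].
Proof.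
exists 4 => H ip m T x y xt u eps d0 rho delta epsilon.
move=> hip m_ge2 Tmax S0 alg d0E rho_gt0 delta_gt0 epsilon_gt0.
have m_gt0 : (0 < m)%N by exact: ltnW.
have mR_gt0 : 0 < m%:R :> R by rewrite ltr0n.
set N := Num.max 1 _.
have : (1 <= N) && (Num.ceil (Num.sqrt m%:R * d0 / rho) <= N)
    && (Num.ceil (d0 / delta) <= N) && (Num.ceil (d0 ^+ 2 / epsilon) <= N).
  by rewrite /N !le_max !lexx !orbT.
rewrite !ceil_le_int -(ler_int R) => /andP[/andP[/andP[N_ge1]]].
rewrite !ler_pdivrMr // => N_rho N_delta N_epsilon.
have NE : (`|N|%N)%:R = N%:~R :> R.
  by rewrite natr_absz ger0_norm // -(ler_int R); apply: le_trans N_ge1.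
pose k := (4 * `|N|)%N.
have kE : k%:R = 4 * N%:~R :> R by rewrite natrM NE.
have kR_gt0 : 0 < k%:R :> R by lra.
have k_gt0 : (0 < k)%N by rewrite -(ltr0n R).
exists k; split => //; first by rewrite kE.
right.
pose e := ergodic_eps ip xt u eps k.
have e_enl i := ergodic_enlargement alg k_gt0 i.
have e_ge0 i : 0 <= e i := enlargement_ge0 (Tmax i) (e_enl i).
have sum_e_le : \sum_(i < m) e i <= epsilon / 2.
  apply: (@le_trans _ _ (2 / k%:R * d0 ^+ 2)).
    rewrite d0E; apply: le_sqr_dist_prod => //.
    - by apply: sumr_ge0 => i _.
    - by rewrite divr_gt0.
    - by move=> zs; exact: (ergodic_eps_le hip m_gt0 hsigma alg k_gt0).
  rewrite mulrAC ler_pdivrMr // kE; lra.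
(* The errors must be positive while [e i] may vanish: the other half of
   [epsilon] is spread evenly over the indices. *)
exists (fun i => e i + epsilon / 2 / m%:R); split.
- by move=> i; rewrite ltr_wpDl // !divr_gt0.
- move=> i; apply: enlargementW (e_enl i).
  by rewrite lerDl !divr_ge0 // ltW.
- apply: (@le_trans _ _ (2 * Num.sqrt m%:R / k%:R * d0)).
    rewrite d0E; apply: le_dist_prod => //.
      by rewrite divr_gt0 // mulr_gt0 // sqrtr_gt0.
    by move=> zs; exact: (ergodic_sum_u_le hip m_gt0 hsigma alg k_gt0).
  rewrite mulrAC ler_pdivrMr // kE; nra.
- move=> i j; apply: (@le_trans _ _ (4 / k%:R * d0)).
    rewrite d0E; apply: le_dist_prod => //; first by rewrite divr_gt0.
    by move=> zs; exact: (ergodic_xtB_le hip m_gt0 hsigma alg k_gt0).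
  rewrite mulrAC ler_pdivrMr // kE; lra.
- rewrite big_split /= sumr_const card_ord -(mulr_natr (_ / _)).
  rewrite divfK ?gt_eqF //.
  by rewrite [leRHS]splitr lerD2r.
Qed.
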